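(* Let $\mathbb{K}$ be a countable subfield of $\mathbb{R}$. Then, for every $\xi\in\widehat{\mathbb{R}}$ and every double Følner sequence $(F_n)$ in $\mathbb{K}$, the sequence $$u_n := \frac{1}{|F_n|}\sum_{a\in F_n\setminus\{0\}} \xi(a^{-1}), \quad n\geq 1,$$ does not converge to zero as $n\to\infty$.
   Context: $\widehat{\mathbb{R}}$ denotes the set of continuous characters (continuous homomorphisms to $\mathbb{S}^1$) of $(\mathbb{R},+)$ with its usual topology. A double Følner sequence in $\mathbb{K}$ is a sequence $(F_n)$ of non-empty finite subsets of $\mathbb{K}$ that is asymptotically invariant under both addition and multiplication: $|F_n \cap (F_n + b)|/|F_n| \to 1$ for every $b \in \mathbb{K}$ and $|F_n\cap aF_n|/|F_n| \to 1$ for every $a \in \mathbb{K}^*$. *)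

(* Defs.v *)
From mathcomp Require Import all_boot all_order all_algebra finmap complex.
From mathcomp Require Import all_classical all_reals all_analysis.

Set Implicit Arguments.
Unset Strict Implicit.
Unset Printing Implicit Defensive.

Import Order.TTheory GRing.Theory Num.Theory.
Import numFieldNormedType.Exports.

Local Open Scope classical_set_scope.
Local Open Scope ring_scope.

(* The topology of C is carried by the alias R[i]^o: the norm of R[i] takes
   its values in R[i], and the library puts the induced topology on R[i]^o. *)
Definition is_character (R : realType) (xi : R -> R[i]^o) : Prop :=
  [/\ continuous xi,
      forall x, `|xi x| = 1
    & forall x y, xi (x + y) = xi x * xi y].

(* |A `&` B| / |A| *)
Definition overlap (R : realType) (A B : {fset R}) : R :=
  #|` (A `&` B)%fset|%:R / #|` A|%:R.

Definition double_folner (R : realType) (K : {pred R}) (F : nat -> {fset R})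
    : Prop :=
  [/\ forall n, F n != fset0,
      forall n, {subset F n <= K},
      forall b, b \in K ->
        overlap (F n) [fset (x + b)%R | x in F n]%fset @[n --> \oo] --> (1 : R)
    & forall a, a \in K -> a != 0 ->
        overlap (F n) [fset (a * x)%R | x in F n]%fset @[n --> \oo] --> (1 : R)].

Definition inv_average (R : realType) (xi : R -> R[i]^o) (A : {fset R})
    : R[i]^o :=
  (#|` A|%:R : R[i])^-1 * \sum_(a <- (A `\ 0)%fset) xi a^-1.

(* Main.v *)
Require Import Defs.
From mathcomp Require Import all_boot all_order all_algebra finmap complex.
From mathcomp Require Import all_classical all_reals all_analysis.
From mathcomp Require Import lra.
Import Order.TTheory GRing.Theory Num.Theory.
Import numFieldNormedType.Exports.
Local Open Scope classical_set_scope.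
Local Open Scope ring_scope.

(** The averages converge to 1, so they cannot converge to 0.

    Almost all elements of [F n] are large in absolute value. Indeed fix
    [M >= 0]: the subfield contains the integers, hence it contains
    arbitrarily many shifts at mutual distance greater than [2 * M]. The
    corresponding translates of the part of [F n] lying in [[-M, M]] are
    pairwise disjoint and, by asymptotic invariance under addition, almost
    contained in [F n]; so this part has density at most about [1 / N] in
    [F n] for every [N] ([disjoint_translates_card] is the count,
    [folner_bounded_part_negligible] the conclusion).

    Hence [a^-1] is close to 0 for almost all [a] in [F n], and there the
    character is close to [xi 0 = 1]; the other terms are bounded and carry
    vanishing weight ([inv_average_deviation], [inv_average_cvg1]). *)

(** Split each translate of [A] along [F]. The parts inside [F] are disjoint,
    so they add up to at most the size of [F]; the part outside [F] lies in
    the same translate of [F] minus [F]. *)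
Lemma disjoint_translates_card (V : zmodType) (F A : {fset V}) (N : nat)
    (b : 'I_N -> V) :
  (A `<=` F)%fset ->
  (forall i j x y, x \in A -> y \in A -> x + b i = y + b j -> i = j) ->
  (N * #|` A| <=
     #|` F| + \sum_(i < N) #|` ([fset (x + b i)%R | x in F] `\` F)%fset|)%N.
Proof.
move=> AF bdisj; pose T i (X : {fset V}) := [fset (x + b i)%R | x in X]%fset.
have cardT i X : #|` T i X| = #|` X| by rewrite card_imfset //; exact: addIr.
have -> : (N * #|` A| = \sum_(i < N) #|` T i A|)%N.
  by under eq_bigr do rewrite cardT; rewrite sum_nat_const card_ord.
apply: (@leq_trans (\sum_(i < N)
  (#|` (F `&` T i A)%fset| + #|` (T i F `\` F)%fset|))%N).
  apply: leq_sum => i _; rewrite -(cardfsID F (T i A)) fsetIC leq_add2l.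
  apply/fsubset_leq_card/fsetSD/fsubsetP => _ /imfsetP [x /= xA ->].
  by apply/imfsetP; exists x => //=; apply: (fsubsetP AF).
rewrite big_split /= leq_add2r.
have cardI i : #|` (F `&` T i A)%fset| = (\sum_(x <- F) (x \in T i A))%N.
  rewrite -sum1_size (eq_fbigl _ (B := [fset x in F | x \in T i A]%fset)).
    by rewrite big_fset /= big_mkcond.
  by move=> x; rewrite !inE.
under eq_bigr do rewrite cardI.
(* Count pairs by [y] in [F]: at most one translate of [A] contains [y]. *)
rewrite exchange_big /= -sum1_size; apply: leq_sum => y _.
case: (pickP (fun i => y \in T i A)) => [i yi|none]; last first.
  by rewrite big1 // => i _; rewrite none.
rewrite (bigD1 i) //= yi big1 ?addn0 // => j ji.
case yj: (y \in T j A) => //; case/negP: ji.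
move: yi yj => /imfsetP [x /= xA yE] /imfsetP [z /= zA zE].
by apply/eqP/(bdisj j i z x) => //; rewrite -zE.
Qed.

(** Turns the limit of the real ratios into an inequality between cardinals,
    usable both in [R] and in [R[i]]. *)
Lemma overlap1_small_defect (R : realType) (F G : nat -> {fset R}) (N : nat) :
  (forall n, F n != fset0) -> (forall n, #|` G n| = #|` F n|) ->
  overlap (F n) (G n) @[n --> \oo] --> (1 : R) ->
  \forall n \near \oo, (N * #|` (G n `\` F n)%fset| <= #|` F n|)%N.
Proof.
move=> F0 GF cvg1; near=> n.
have : 1 - N.+1%:R^-1 < overlap (F n) (G n).
  by near: n; apply: cvgr_gt cvg1 _ _; rewrite ltrBlDr ltrDl invr_gt0 ltr0n.
have Fn_gt0 : 0 < #|` F n|%:R :> R by rewrite ltr0n cardfs_gt0 F0.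
have := cardfsID (F n) (G n); rewrite fsetIC GF /overlap => cardE.
rewrite ltr_pdivlMr // mulrBl mul1r ltrBlDr.
rewrite -{1}cardE natrD ltrD2l ltr_pdivlMl ?ltr0n // -natrM ltr_nat.
rewrite mulSn => /ltnW; apply: leq_trans; exact: leq_addl.
Unshelve. all: by end_near.
Qed.

Lemma natr_divring (R : unitRingType) (K : {pred R}) (n : nat) :
  divring_closed K -> n%:R \in K.
Proof.
case=> K1 KB _; have K0 : 0 \in K by rewrite -(subrr 1) KB.
elim: n => [//|n IHn]; rewrite -natr1 -[X in _ + X]opprK -[X in _ - X]sub0r.
by rewrite !KB.
Qed.

(** Zero density of [F n] in [[-M, M]], as an inequality between naturals so
    that it can be cast to any numeric field. *)
Lemma folner_bounded_part_negligible (R : realType) (K : {pred R})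
    (F : nat -> {fset R}) (M : R) (k : nat) :
  divring_closed K -> double_folner K F ->
  \forall n \near \oo,
    (k * #|` [fset x in F n | (`|x| <= M)%R]%fset| <= #|` F n|)%N.
Proof.
move=> subK [F0 _ trans _].
pose m := (Num.trunc (2 * M)).+1; pose b i : R := (m * i)%:R.
have gap : 2 * M < m%:R by exact: truncnS_gt.
(* Packing 2k translates gives 2k #|A| <= #|F n| + defects, and the defects
   are made to add up to at most #|F n| as well. *)
pose N := k.*2.
have small : \forall n \near \oo, forall i : 'I_N,
    (N * #|` ([fset (x + b i)%R | x in F n] `\` F n)%fset| <= #|` F n|)%N.
  apply: filter_forall => i; apply: overlap1_small_defect => //.
    by move=> n; rewrite card_imfset //; exact: addIr.
  by apply: trans; exact: natr_divring.
apply: filterS small => n small.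
set A := [fset _ in _ | _]%fset.
have AF : (A `<=` F n)%fset by apply/fsubsetP => x; rewrite !inE => /andP[].
have apart (x y : R) (i j : nat) : x \in A -> y \in A -> x + b i = y + b j ->
    (i <= j)%N.
  rewrite !inE => /andP[_ /ler_normlP[xl xr]] /andP[_ /ler_normlP[yl yr]].
  rewrite leqNgt /b => e; apply/negP => ji.
  have : (m + m * j <= m * i)%N by rewrite -mulnS leq_mul2l ji orbT.
  rewrite -(ler_nat R) natrD => h; lra.
have disj (i j : 'I_N) x y :
    x \in A -> y \in A -> x + b i = y + b j -> i = j.
  move=> xA yA e; apply/val_inj/eqP.
  by rewrite eqn_leq (apart x y) //= (apart y x).
have packing := disjoint_translates_card _ _ _ _ (fun i => b i) AF disj.
have [k0|k_gt0] := posnP k; first by rewrite k0.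
have : (N * \sum_(i < N) #|` ([fset (x + b i)%R | x in F n] `\` F n)%fset| 
        <= N * #|` F n|)%N.
  rewrite big_distrr /= -[X in (_ <= X * _)%N]card_ord -sum_nat_const.
  exact: leq_sum.
rewrite leq_pmul2l ?double_gt0 // => le_sum.
have := leq_trans packing (leq_add (leqnn _) le_sum).
by rewrite addnn -doubleMl leq_double.
Qed.

(** The terms with [`|a| <= M] deviate from 1 by at most 2, the others by at
    most [e]. The summand at [a = 0], absent from the average, is counted as
    the value 0: it deviates by 1. *)
Lemma inv_average_deviation (R : realType) (xi : R -> R[i]^o) (A : {fset R})
    (M : R) (e : R[i]) :
  A != fset0 -> 0 <= M -> 0 <= e -> (forall x, `|xi x| = 1) ->
  (forall a, M < `|a| -> `|1 - xi a^-1| <= e) ->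
  `|1 - inv_average xi A| <=
     2 * #|` [fset x in A | (`|x| <= M)%R]%fset|%:R / #|` A|%:R + e.
Proof.
move=> A0 M0 e0 xi1 xi_near.
have A_gt0 : 0 < #|` A|%:R :> R[i] by rewrite ltr0n cardfs_gt0.
pose g a : R[i] := if a == 0 then 0 else xi a^-1.
have sumE : \sum_(a <- (A `\ 0)%fset) xi a^-1 = \sum_(a <- A) g a :> R[i].
  rewrite -(@big_fset_incl _ _ _ _ (A `\ 0)%fset A g) ?fsubD1set //.
    by apply: eq_big_seq => a; rewrite !inE /g => /andP[/negPf ->].
  by move=> a aA; rewrite !inE aA andbT negbK /g => ->.
have -> : 1 - inv_average xi A = #|` A|%:R^-1 * \sum_(a <- A) (1 - g a).
  rewrite /inv_average sumE sumrB mulrBr; congr (_ - _).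
  by rewrite big_const_seq count_predT iter_addr_0 mulVf ?gt_eqF.
rewrite normrM ger0_norm ?invr_ge0 ?ler0n // mulrC ler_pdivrMr //.
rewrite mulrDl divfK ?gt_eqF //.
apply: le_trans (ler_norm_sum _ _ _) _.
have -> : #|` [fset x in A | (`|x| <= M)%R]%fset|%:R
            = \sum_(a <- A) (`|a| <= M)%R%:R :> R[i].
  rewrite -sum1_size natr_sum big_fset /= big_mkcond /=.
  by apply: eq_bigr => a _; case: ifP.
have -> : e * #|` A|%:R = \sum_(a <- A) e.
  by rewrite big_const_seq count_predT iter_addr_0 mulr_natr.
rewrite mulr_sumr -big_split /=; apply: ler_sum => a _.
have [aM|aM] := leP `|a| M; last first.
  rewrite mulr0 add0r /g -normr_eq0 gt_eqF ?(le_lt_trans M0) //.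
  exact: xi_near.
rewrite mulr1; apply: le_trans (ler_normB _ _) _.
rewrite -[leLHS]addr0 lerD // normr1 -[2]/(1 + 1) lerD2l /g.
by case: ifP => _; rewrite ?normr0 // xi1.
Qed.

Lemma character_inv_at_infinity (R : realType) (xi : R -> R[i]^o) (e : R[i]) :
  is_character xi -> 0 < e ->
  exists2 M : R, 0 <= M & forall a, M < `|a| -> `|1 - xi a^-1| <= e.
Proof.
case=> xi_cont xi1 xiD e0.
have xi0 : xi 0 = 1.
  have nz : xi 0 != 0 by rewrite -normr_eq0 xi1 oner_eq0.
  by apply: (mulfI nz); rewrite -xiD addr0 mulr1.
have /cvgrPdist_le /(_ e e0) := xi_cont 0; rewrite xi0.
move=> /nbhs_ballP [d /= d0 near0].
exists d^-1 => [|a da]; first by rewrite invr_ge0 ltW.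
apply: near0; rewrite -ball_normE /= sub0r normrN normfV.
by rewrite invf_plt // posrE (lt_trans _ da) ?invr_gt0.
Qed.

Lemma complex_natr_gt (R : realType) (z : R[i]) :
  0 <= z -> exists k : nat, z < k%:R.
Proof.
move=> z0; exists ((Num.trunc (complex.Re z)).+1).
rewrite -(RRe_real (ger0_real z0)) -(rmorph_nat (real_complex R)) ltcR.
exact: truncnS_gt.
Qed.

Lemma inv_average_cvg1 (R : realType) (K : {pred R}) (xi : R -> R[i]^o)
    (F : nat -> {fset R}) :
  divring_closed K -> is_character xi -> double_folner K F ->
  inv_average xi (F n) @[n --> \oo] --> (1 : R[i]^o).
Proof.
move=> subK xi_char folner; have [F0 _ _ _] := folner.
have [_ xi1 _] := xi_char.
apply/cvgrPdist_le => e e0; have e20 : 0 < e / 2 by rewrite divr_gt0.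
have [M M0 xi_near] := character_inv_at_infinity _ _ _ xi_char e20.
have [k k_large] : exists k : nat, 2 / (e / 2) < k%:R.
  by apply: complex_natr_gt; rewrite divr_ge0 // ltW.
have sparse := folner_bounded_part_negligible _ _ _ M k subK folner.
apply: filterS sparse => n sparse.
have := inv_average_deviation _ _ _ _ _ (F0 n) M0 (ltW e20) xi1 xi_near.
move=> /le_trans; apply.
have Fn_gt0 : 0 < #|` F n|%:R :> R[i] by rewrite ltr0n cardfs_gt0 F0.
rewrite [leRHS]splitr lerD2r ler_pdivrMr //.
rewrite ltr_pdivrMr // in k_large.
set c := #|` _|%:R.
apply: (@le_trans _ _ (k%:R * (e / 2) * c)).
  by rewrite ler_wpM2r ?ler0n // ltW.
rewrite mulrAC mulrC ler_wpM2l ?(ltW e20) // -natrM ler_nat.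
exact: sparse.
Qed.

Theorem theorem1p11 (R : realType) (K : {pred R})
  (K_subfield : divring_closed K) (K_countable : countable [set` K])
  (xi : R -> R[i]^o) (xi_character : is_character xi)
  (F : nat -> {fset R}) (F_folner : double_folner K F) :
  ~ (inv_average xi (F n) @[n --> \oo] --> (0 : R[i]^o)).
Proof.
move=> cvg0.
have cvg1 := inv_average_cvg1 _ _ _ _ K_subfield xi_character F_folner.
have e01 : (0 : R[i]) = 1.
  exact: (@cvg_unique R[i]^o (@norm_hausdorff _ _) _ _ _ _ cvg0 cvg1).
by move/esym/eqP: e01; rewrite oner_eq0.
Qed.
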